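(* Let $k\ge1$, $c\ge0$, $n>k$ be integers and $s>0$. Let $C_c,T_c$ be the cost (with task cancellation) and execution time of a job of $k$ tasks when each task is launched at time $0$ together with $c$ replicas, and let $C_n,T_n$ be those when the job is launched at time $0$ with $n-k$ additional coded tasks (definitions in the context). (i) If task execution times are i.i.d. $\mathrm{SExp}(s,\mu)$ with $\mu>0$, then $$\mathbb E[T_c]=s+\frac{H_k}{(c+1)\mu},\quad \mathbb E[C_c]=k\Bigl((c+1)s+\frac1\mu\Bigr),\quad \mathbb E[T_n]=s+\frac1\mu(H_n-H_{n-k}),\quad \mathbb E[C_n]=ns+\frac k\mu .$$ (ii) If task execution times are i.i.d. $\mathrm{Pareto}(s,\alpha)$ with $\alpha>1$, then $$\mathbb E[T_c]=s\,k!\,\frac{\Gamma\bigl(1-\frac{1}{(c+1)\alpha}\bigr)}{\Gamma\bigl(k+1-\frac{1}{(c+1)\alpha}\bigr)},\qquad \mathbb E[C_c]=s\,k(c+1)\frac{\alpha}{\alpha-\frac1{c+1}},$$ $$\mathbb E[T_n]=s\,\frac{n!}{(n-k)!}\,\frac{\Gamma(n-k+1-1/\alpha)}{\Gamma(n+1-1/\alpha)},$$ $$\mathbb E[C_n]=s\,\frac{n}{\alpha-1}\Bigl(\alpha-\frac{\Gamma(n)}{\Gamma(n-k)}\frac{\Gamma(n-k+1-1/\alpha)}{\Gamma(n+1-1/\alpha)}\Bigr).$$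
   Context: $\mathrm{SExp}(s,\mu)$: $\Pr\{X>x\}=e^{-\mu(x-s)}$ for $x\ge s$, and $1$ for $x<s$. $\mathrm{Pareto}(s,\alpha)$: $\Pr\{X>x\}=(s/x)^\alpha$ for $x\ge s$, and $1$ for $x<s$. $H_m=\sum_{i=1}^m 1/i$, $H_0=0$. Zero-delay replication: with i.i.d. copies $X_{i,l}$, $1\le i\le k$, $0\le l\le c$, all launched at time $0$, task $i$ completes at $Y_i=\min_{0\le l\le c}X_{i,l}$, at which moment its other copies are cancelled; $T_c=\max_iY_i$ and $C_c=(c+1)\sum_{i=1}^kY_i$. Zero-delay coding: with $n$ i.i.d. tasks $X_1,\dots,X_n$ launched at time $0$, the job completes when any $k$ of them complete and the remaining tasks are then cancelled; $T_n=X_{n:k}$, the $k$-th smallest of $X_1,\dots,X_n$, and $C_n=\sum_{i=1}^n\min(X_i,X_{n:k})=\sum_{i=1}^kX_{n:i}+(n-k)X_{n:k}$. Cost is the total lifetime of all launched tasks. *)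

(* Defs.v *)
From HB Require Import structures.
From mathcomp Require Import all_boot all_order all_algebra.
From mathcomp Require Import all_classical all_reals all_analysis.

Set Implicit Arguments.
Unset Strict Implicit.
Unset Printing Implicit Defensive.

Import Order.TTheory GRing.Theory Num.Theory.

Local Open Scope classical_set_scope.
Local Open Scope ring_scope.

Section SpecialFunctions.
Context {R : realType}.

Definition harmonic_number (m : nat) : R := \sum_(1 <= i < m.+1) i%:R^-1.

(* Euler's integral, hence meaningful for 0 < z only. *)
Definition Gamma (z : R) : R :=
  \int[lebesgue_measure]_(t in `]0, +oo[) (t `^ (z - 1) * expR (- t)).

End SpecialFunctions.

Section Distributions.
Context {d : measure_display} {Omega : measurableType d} {R : realType}.
Variable P : probability Omega R.

Definition mutually_independent (I : finType) (X : I -> {RV P >-> R}) : Prop :=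
  forall (J : {set I}) (B : I -> set R), (forall i, measurable (B i)) ->
    P (\bigcap_(i in [set` J]) (X i @^-1` B i)) =
    (\prod_(i in J) P (X i @^-1` B i))%E.

(* [ccdf X x] is the tail probability Pr(X > x). *)
Definition has_SExp_law (s mu : R) (X : {RV P >-> R}) : Prop :=
  forall x : R,
    ccdf X x = (if s <= x then expR (- mu * (x - s)) else 1)%:E.

Definition has_Pareto_law (s alpha : R) (X : {RV P >-> R}) : Prop :=
  forall x : R, ccdf X x = (if s <= x then (s / x) `^ alpha else 1)%:E.

End Distributions.

Section Replication.
Context {Omega : Type} {R : realType} {k c : nat}.
Implicit Types X : 'I_k -> 'I_c.+1 -> Omega -> R.

Definition rep_task_time X (i : 'I_k) (w : Omega) : R :=
  \big[Num.min/X i ord0 w]_(l < c.+1) X i l w.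

(* The default value of the iterated maximum is one of the task times, so that
   this is the true maximum; [k_gt0] only provides the index. *)
Definition rep_time (k_gt0 : (0 < k)%N) X (w : Omega) : R :=
  \big[Num.max/rep_task_time X (Ordinal k_gt0) w]_(i < k) rep_task_time X i w.

(* All [c.+1] copies of task [i] run from time 0 until the first one ends. *)
Definition rep_cost X (w : Omega) : R :=
  c.+1%:R * \sum_(i < k) rep_task_time X i w.

End Replication.

Section Coding.
Context {Omega : Type} {R : realType} {n : nat}.
Implicit Types X : 'I_n -> Omega -> R.

(* The [j]-th smallest value, counted with multiplicity, for 1 <= j <= n. *)
Definition order_stat X (j : nat) (w : Omega) : R :=
  nth 0 (sort <=%R [seq X i w | i <- enum 'I_n]) j.-1.

Definition cod_time X (k : nat) (w : Omega) : R := order_stat X k w.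

Definition cod_cost X (k : nat) (w : Omega) : R :=
  \sum_(i < n) Num.min (X i w) (cod_time X k w).

End Coding.

(* Main.v *)
(** Replication and coding are both governed by order statistics: with [g] the
    common tail of [n] independent lifetimes, the [k]-th smallest exceeds [x] iff
    fewer than [k] of them are at most [x], so its tail is
    [\sum_(j < k) 'C(n, j) (1 - g)^j g^(n - j)], and the expectation is the
    integral of this tail.  In both families [\int_s^oo g^m = kappa / (m - a)],
    with [(kappa, a) = (1 / mu, 0)] for SExp and [(s / alpha, 1 / alpha)] for
    Pareto, whence [\int_s^oo (1 - g)^j g^m = kappa j! / ((m + j - a) ... (m - a))]
    by induction on [j].  Since [min(X_(j), X_(k)) = X_(min(j, k))], the cost is
    also a sum of order statistics.  The minimum of [c + 1] replicas stays in the
    family, with rate [(c + 1) mu] or exponent [(c + 1) alpha], so that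
    replication is the case [n = k].  The functional equation of [Gamma] turns
    the products into the stated quotients. *)

Require Import Defs.
From HB Require Import structures.
From mathcomp Require Import all_boot all_order all_algebra.
From mathcomp Require Import all_classical all_reals all_analysis.
From mathcomp Require Import measurable_realfun ring zify.

Set Implicit Arguments.
Unset Strict Implicit.
Unset Printing Implicit Defensive.

Import Order.TTheory GRing.Theory Num.Theory.
Import numFieldNormedType.Exports.

Local Open Scope classical_set_scope.
Local Open Scope ring_scope.

(** * Integrals of exponentials and powers *)

Section Integrals.
Context {R : realType}.
Notation mu := (@lebesgue_measure R).

Lemma is_derive_continuous (f : R -> R) (x df : R) :
  is_derive x 1 f df -> {for x, continuous f}.
Proof.
by move=> d; apply: differentiable_continuous; apply/derivable1_diffP/ex_derive.
Qed.

(** Two-sided continuity and differentiability are asked at [a] as well, which settles the one-sided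
    endpoint conditions at once; the antiderivatives used below are smooth past their left
    endpoint. *)
Lemma ge0_is_derive_FTC2y (f F : R -> R) (a l : R) :
  (forall x, a <= x -> 0 <= f x) ->
  (forall x, a <= x -> {for x, continuous f}) ->
  (forall x, a <= x -> is_derive x 1 F (f x)) -> F x @[x --> +oo] --> l ->
  (\int[mu]_(x in `[a, +oo[) (f x)%:E = (l - F a)%:E)%E.
Proof.
move=> f0 cf dF Fl; rewrite EFinB; apply: ge0_continuous_FTC2y => //.
- apply/continuous_within_itvcyP; split.
    by move=> x; rewrite in_itv/= andbT => /ltW; exact: cf.
  by apply: cvg_at_right_filter; exact: cf.
- by move=> x /ltW/dF dx; exact: ex_derive.
- by apply: cvg_at_right_filter; exact: is_derive_continuous (dF _ (lexx a)).
- by move=> x; rewrite in_itv/= andbT derive1E => /ltW/dF dx; exact: derive_val.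
Qed.

Lemma continuous_powR (a x : R) : 0 < x -> {for x, continuous (@powR R ^~ a)}.
Proof. by move=> x0; exact: is_derive_continuous (is_derive1_powR a x0). Qed.

Lemma cvgy_expRN0 (f : R -> R) : f x @[x --> +oo] --> (+oo : set_system R) ->
  expR (- f x) @[x --> +oo] --> (0 : R).
Proof.
move=> fy; apply: (@cvg_comp _ _ _ f (fun y => expR (- y)) _ (pinfty_nbhs R)) => //.
exact: cvgr_expR.
Qed.

Lemma ln_cvgy : ln x @[x --> +oo] --> (+oo : set_system R).
Proof.
apply/cvgryPge => M; near=> x.
by rewrite -(expRK M) ler_ln ?posrE ?expR_gt0.
Unshelve. all: end_near. Qed.

Lemma powR_cvgy0 (a : R) : a < 0 -> x `^ a @[x --> +oo] --> (0 : R).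
Proof.
move=> a0; apply: (@cvg_trans _ (expR (- (- a * ln x)) @[x --> +oo])).
  by apply: near_eq_cvg; near=> x; rewrite /powR gt_eqF ?mulNr ?opprK.
apply: cvgy_expRN0; apply: gt0_cvgMry; [by rewrite oppr_gt0|exact: ln_cvgy].
Unshelve. all: end_near. Qed.

Lemma measurable_expR_affine (D : set R) (m s : R) :
  measurable_fun D (fun x => expR (m * (x - s))).
Proof.
apply: measurableT_comp => //; apply: measurable_funM => //.
exact: measurable_funB.
Qed.

Lemma integral_expR_tail (m s : R) : 0 < m ->
  (\int[mu]_(x in `[s, +oo[) (expR (- m * (x - s)))%:E = m^-1%:E)%E.
Proof.
move=> m0.
have dl (x : R) : is_derive x 1 (fun x : R => - m * (x - s)) (- m).
  by apply: is_derive_eq; rewrite /GRing.scale/= subr0 mulr1.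
have dE (x : R) : is_derive x 1 (fun x => - m^-1 * expR (- m * (x - s)))
    (expR (- m * (x - s))).
  apply: is_derive_eq.
  by rewrite /GRing.scale/= mulrCA mulrNN mulVf ?mulr1// gt_eqF.
rewrite (@ge0_is_derive_FTC2y _ _ _ 0 _ _ (fun x _ => dE x) _).
- by rewrite subrr mulr0 expR0 mulr1 sub0r opprK.
- by move=> x _; exact: expR_ge0.
- by move=> x _; apply: is_derive_continuous.
- rewrite -(mulr0 (- m^-1)); apply: cvgMr.
  under eq_fun do rewrite mulNr.
  by apply: cvgy_expRN0; apply: gt0_cvgMry => //; apply: cvg_addrr.
Qed.

Lemma integral_powR_tail (b s : R) : 0 < s -> 1 < b ->
  (\int[mu]_(x in `[s, +oo[) ((s / x) `^ b)%:E = (s / (b - 1))%:E)%E.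
Proof.
move=> s0 b1.
pose F x := (s `^ b / (1 - b)) * x `^ (1 - b).
transitivity (\int[mu]_(x in `[s, +oo[) (s `^ b * x `^ (- b))%:E)%E.
  apply: eq_integral => x; rewrite inE/= in_itv/= andbT => sx.
  have x0 : 0 < x by exact: lt_le_trans sx.
  by rewrite powRM ?invr_ge0 ?ltW// -[x^-1]powR_inv1 ?ltW// -powRrM mulN1r.
have dF x : s <= x -> is_derive x 1 F (s `^ b * x `^ (- b)).
  move=> sx; have dx := is_derive1_powR (1 - b) (lt_le_trans s0 sx).
  apply: is_derive_eq.
  rewrite /GRing.scale/= mulrA divfK ?subr_eq0 ?lt_eqF//.
  by congr (_ * _ `^ _); ring.
rewrite (@ge0_is_derive_FTC2y _ _ _ 0 _ _ dF _).
- congr EFin; rewrite sub0r /F mulrAC -powRD; last first.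
    by apply/implyP => _; rewrite gt_eqF.
  by rewrite addrC subrK powRr1 ?ltW// -mulrN -invrN opprB.
- by move=> x _; rewrite mulr_ge0 ?powR_ge0.
- by move=> x sx; apply: cvgMr; apply: continuous_powR; exact: lt_le_trans sx.
- rewrite -(mulr0 (s `^ b / (1 - b))); apply: cvgMr.
  by apply: powR_cvgy0; rewrite subr_lt0.
Qed.

(** For [z < 1] the integrand is unbounded near 0, so the fundamental theorem is applied on compact
    intervals that exhaust the half-open one, and monotone convergence gives the limit. *)
Lemma integral_powR_head (z t : R) : 0 < z -> 0 < t ->
  (\int[mu]_(u in `]0%R, t]) (z * u `^ (z - 1))%:E = (t `^ z)%:E)%E.
Proof.
(* The shift to [n.+2] makes [e n < t] strict already at [n = 0]. *)
move=> z0 t0.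
pose e n : R := t * n.+2%:R^-1.
have e0 n : 0 < e n by rewrite mulr_gt0 ?invr_gt0.
have et n : e n < t by rewrite gtr_pMr// invf_lt1// ltr1n.
pose F n : set R := `[e n, t]%classic.
have FU : `]0, t]%classic = \bigcup_n F n.
  apply/seteqP; split => x /=; rewrite in_itv/=.
    move=> /andP[x0 xt]; pose n := Num.bound (t / x).
    exists n => //=; rewrite /F/= in_itv/= xt andbT /e ler_pdivrMr//.
    rewrite mulrC -ler_pdivrMr//; have := archi_boundP (divr_ge0 (ltW t0) (ltW x0)).
    by move=> /ltW/le_trans; apply; rewrite ler_nat -/n -addn2 leq_addr.
  move=> [n _]; rewrite /F/= in_itv/= => /andP[ex ->]; rewrite andbT.
  exact: lt_le_trans ex.
have mf : measurable_fun [set: R] (EFin \o (fun u => z * u `^ (z - 1))).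
  apply/measurable_EFinP; exact: measurable_funM.
have ndF : nondecreasing_seq F.
  apply/nondecreasing_seqP => n; rewrite subsetEset; apply: subset_itvr.
  by rewrite bnd_simp ler_pM2l// lef_pV2 ?posrE// ler_nat.
have cF := @ge0_nondecreasing_set_cvg_integral _ (measurableTypeR R) R F _ mu ndF
  (fun=> measurable_itv _) (fun=> measurable_funTS mf) _.
rewrite FU; apply: (cvg_unique _ (cF _)) => //.
  by move=> n x _; rewrite lee_fin mulr_ge0 ?powR_ge0// ltW.
(* The integral over [F n] is [t^z - (e n)^z], and the second term vanishes in the limit because
   [0 < z]. *)
apply: (@cvg_trans _ ((t `^ z - e n `^ z)%:E @[n --> \oo])).
  apply: near_eq_cvg; near=> n; rewrite EFinB.
  have dP x : e n <= x -> is_derive x 1 (@powR R ^~ z) (z * x `^ (z - 1)).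
    by move=> ex; apply: is_derive1_powR; exact: lt_le_trans ex.
  rewrite (@continuous_FTC2 _ _ (@powR R ^~ z))//.
  - apply/continuous_within_itvP => //; split.
    + move=> x; rewrite in_itv/= => /andP[ex _]; apply: cvgMr.
      by apply: continuous_powR; exact: lt_trans ex.
    + by apply: cvg_at_right_filter; apply: cvgMr; exact: continuous_powR.
    + by apply: cvg_at_left_filter; apply: cvgMr; exact: continuous_powR.
  - split.
    + by move=> x; rewrite in_itv/= => /andP[/ltW/dP dx _]; exact: ex_derive.
    + by apply: cvg_at_right_filter; exact: continuous_powR.
    + by apply: cvg_at_left_filter; exact: continuous_powR.
  - move=> x; rewrite in_itv/= derive1E => /andP[/ltW/dP dx _].
    exact: derive_val.
apply: cvg_EFin; first exact: nearW.
rewrite -[X in _ --> X]subr0; apply: cvgB; first exact: cvg_cst.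
apply: ((cvg_at_rightP _ _ _).1 (powR_cvg0 z0) e); split => //.
rewrite -(mulr0 t); apply: cvgMr.
rewrite (_ : (fun n => _) = (fun n => harmonic n.+1))// cvg_shiftS.
exact: cvg_harmonic.
Unshelve. all: end_near. Qed.

End Integrals.

(** * Euler's Gamma function *)

Section GammaFunction.
Context {R : realType}.
Notation mu := (@lebesgue_measure R).

(** Kept in the extended reals so that Tonelli and monotonicity apply before finiteness is known;
    [EGamma_lty] later allows the passage to the real-valued [Gamma]. *)
Let EGamma (z : R) : \bar R :=
  (\int[mu]_(t in `]0%R, +oo[) (t `^ (z - 1) * expR (- t))%:E)%E.

Let measurable_Gamma_integrand (z : R) :
  measurable_fun [set: R] (EFin \o (fun t => t `^ (z - 1) * expR (- t))).
Proof.
apply/measurable_EFinP; apply: measurable_funM => //.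
by apply: measurableT_comp => //; exact: measurable_funN.
Qed.

Let EGamma_ge0 z : (0 <= EGamma z)%E.
Proof.
by apply: integral_ge0 => t _; rewrite lee_fin mulr_ge0 ?powR_ge0 ?expR_ge0.
Qed.

(* Tonelli on the region [0 < u <= t], with
   [t^z = \int_0^t z u^(z-1) du] and [e^-u = \int_u^oo e^-t dt]. *)
Let EGammaS z : 0 < z -> EGamma (z + 1) = (z%:E * EGamma z)%E.
Proof.
move=> z0.
pose D := [set p : R * R | 0 < p.2 <= p.1].
have Dmem t u : ((t, u) \in D) = (0 < u <= t) by apply/idP/idP; rewrite inE.
pose w u := z * u `^ (z - 1).
have w0 u : 0 <= w u by rewrite mulr_ge0 ?powR_ge0// ltW.
pose h (p : R * R) := ((\1_D p : R) * (w p.2 * expR (- p.1)))%:E.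
have h0 p : (0 <= h p)%E.
  by rewrite /h lee_fin mulr_ge0 ?mulr_ge0 ?powR_ge0 ?expR_ge0 ?(ltW z0)// indicE ler0n.
have mw : measurable_fun [set: R] w by exact: measurable_funM.
have mD : measurable D.
  rewrite (_ : D = [set p | 0 < p.2] `&` [set p | p.2 <= p.1]); last first.
    by apply/seteqP; split => p /=; [move=> /andP[]|move=> [p0 p1]; apply/andP].
  apply: measurableI; rewrite -[X in measurable X]setTI.
    exact: (@measurable_fun_ltr _ _ _ _ (fun=> 0) snd).
  exact: (@measurable_fun_ler _ _ _ _ snd fst).
have mh : measurable_fun setT h.
  apply/measurable_EFinP; apply: measurable_funM; first exact: measurable_indic.
  apply: measurable_funM; first exact: measurableT_comp.
  by apply: measurableT_comp => //; exact: measurableT_comp.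
have int_u t : (\int[mu]_u h (t, u) =
    ((fun t => (t `^ (z + 1 - 1) * expR (- t))%:E) \_ `]0%R, +oo[) t)%E.
  rewrite patchE; case: ifPn; rewrite mem_setE in_itv/= andbT => t0; last first.
    rewrite integral0_eq// => u _; rewrite /h indicE memNset ?mul0r//=.
    by move=> /andP[u0 ut]; move: t0; rewrite (lt_le_trans u0 ut).
  transitivity (\int[mu]_(u in `]0%R, t]) ((expR (- t))%:E * (w u)%:E))%E.
    rewrite [RHS]integral_mkcond; apply: eq_integral => u _.
    rewrite patchE mem_setE in_itv/= /h indicE Dmem -EFinM [w u * _]mulrC.
    by case: ifP => _; rewrite ?mul1r ?mul0r.
  rewrite ge0_integralZl_EFin ?expR_ge0//.
  - by rewrite integral_powR_head// addrK -EFinM mulrC.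
  - by move=> u _; rewrite lee_fin.
  - by apply/measurable_EFinP; exact: measurable_funTS.
have int_t u : (\int[mu]_t h (t, u) =
    ((fun u => z%:E * (u `^ (z - 1) * expR (- u))%:E) \_ `]0%R, +oo[) u)%E.
  rewrite patchE; case: ifPn; rewrite mem_setE in_itv/= andbT => u0; last first.
    rewrite integral0_eq// => t _; rewrite /h indicE memNset ?mul0r//=.
    by move=> /andP[u0' _]; move: u0; rewrite u0'.
  transitivity (\int[mu]_(t in `[u, +oo[)
      ((w u * expR (- u))%:E * (expR (- 1 * (t - u)))%:E))%E.
    rewrite [RHS]integral_mkcond; apply: eq_integral => t _.
    rewrite patchE mem_setE in_itv/= andbT /h indicE Dmem u0/=.
    case: ifP => _; rewrite ?mul0r// mul1r -EFinM.
    by rewrite -[in RHS](mulrA (w u)) -expRD; congr (_ * expR _)%:E; ring.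
  have wu0 : 0 <= w u * expR (- u) by apply: mulr_ge0; rewrite ?expR_ge0.
  rewrite ge0_integralZl_EFin//.
  - by rewrite integral_expR_tail// invr1 mule1 -EFinM mulrA.
  - by apply/measurable_EFinP; exact: measurable_expR_affine.
transitivity (\int[mu]_t \int[mu]_u h (t, u))%E.
  by rewrite /EGamma integral_mkcond; apply: eq_integral => t _; rewrite int_u.
rewrite fubini_tonelli//.
transitivity (\int[mu]_(u in `]0%R, +oo[) (z%:E * (u `^ (z - 1) * expR (- u))%:E))%E.
  by rewrite [RHS]integral_mkcond; apply: eq_integral => u _; rewrite int_t.
rewrite ge0_integralZl_EFin ?ltW//.
- by move=> t _; rewrite lee_fin mulr_ge0 ?powR_ge0 ?expR_ge0.
- exact: measurable_funTS (measurable_Gamma_integrand _).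
Qed.

Let EGamma1 : EGamma 1 = 1%E.
Proof.
rewrite /EGamma; under eq_integral do rewrite subrr powRr0 mul1r.
rewrite integral_itv_obnd_cbnd; last first.
  apply/measurable_EFinP; apply: measurable_funTS.
  by apply: measurableT_comp => //; exact: measurable_funN.
transitivity (1^-1 : R)%:E; last by rewrite invr1.
apply: etrans (integral_expR_tail 0 ltr01).
by apply: eq_integral => t _; rewrite mulN1r subr0.
Qed.

Let EGamma_nat n : (EGamma n.+1%:R < +oo)%E.
Proof.
elim: n => [|n IH]; first by rewrite EGamma1 ltry.
by rewrite -natr1 EGammaS// lte_mul_pinfty ?lee_fin.
Qed.

(** For [1 <= y <= m] one has [t^(y-1) <= 1 + t^m], so [EGamma y] is at most
    [EGamma 1 + EGamma m.+1]. A general [z > 0] is reached from [z + 1] by the functional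
    equation. *)
Let EGamma_lty z : 0 < z -> (EGamma z < +oo)%E.
Proof.
move=> z0.
have EG1 y : 1 <= y -> (EGamma y < +oo)%E.
  move=> y1; pose m := Num.bound y.
  have ym : y <= m%:R by exact/ltW/archi_boundP/(le_trans ler01).
  apply: (@le_lt_trans _ _ (EGamma 1 + EGamma m.+1%:R)%E); last first.
    by rewrite lte_add_pinfty// EGamma1 ltry.
  rewrite -ge0_integralD//; first last.
  - exact: measurable_funTS (measurable_Gamma_integrand _).
  - by move=> t _; rewrite lee_fin mulr_ge0 ?powR_ge0 ?expR_ge0.
  - exact: measurable_funTS (measurable_Gamma_integrand _).
  - by move=> t _; rewrite lee_fin mulr_ge0 ?powR_ge0 ?expR_ge0.
  apply: ge0_le_integral => //.
  - by move=> t _; rewrite lee_fin mulr_ge0 ?powR_ge0 ?expR_ge0.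
  - exact: measurable_funTS (measurable_Gamma_integrand _).
  - by apply: emeasurable_funD; exact: measurable_funTS (measurable_Gamma_integrand _).
  move=> t; rewrite /= in_itv/= andbT => t0.
  rewrite -EFinD lee_fin -mulrDl ler_wpM2r ?expR_ge0// subrr powRr0.
  have [t1|t1] := leP 1 t.
    by apply: ler_wpDl => //; rewrite ler_powR// lerB// (le_trans ym)// ler_nat.
  apply: ler_wpDr; rewrite ?powR_ge0// -[leRHS](powRr0 t).
  by rewrite ger_powR ?t0 ?(ltW t1) ?subr_ge0.
have := EG1 (z + 1); rewrite lerDr ltW// EGammaS// => /(_ isT).
have := EGamma_ge0 z; case: (EGamma z) => [r _ _||//]; first exact: ltry.
by rewrite gt0_muley.
Qed.

(** On [t >= 1] the integrand at [z + 1] dominates [e^-t], whose integral is positive; the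
    functional equation then forbids [EGamma z = 0]. *)
Let EGamma_gt0 z : 0 < z -> (0 < EGamma z)%E.
Proof.
move=> z0.
have EG1 : (0 < EGamma (z + 1))%E.
  apply: (@lt_le_trans _ _ (\int[mu]_(t in `[1%R, +oo[)
      (expR (-1) * expR (- 1 * (t - 1)))%:E)%E).
    under eq_integral do rewrite EFinM.
    rewrite ge0_integralZl_EFin ?expR_ge0//.
    - by rewrite integral_expR_tail// invr1 mule1 lte_fin expR_gt0.
    - apply/measurable_EFinP; apply: measurableT_comp => //.
      by apply: measurable_funM => //; exact: measurable_funB.
  apply: (@le_trans _ _ (\int[mu]_(t in `[1%R, +oo[)
      (t `^ (z + 1 - 1) * expR (- t))%:E)%E).
    apply: ge0_le_integral => //.
    - apply/measurable_EFinP; apply: measurable_funM => //.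
      exact: measurable_expR_affine.
    - exact: measurable_funTS (measurable_Gamma_integrand _).
    move=> t; rewrite /= in_itv/= andbT => t1; rewrite lee_fin -expRD.
    rewrite mulN1r opprB addrA addNr sub0r ler_peMl ?expR_ge0//.
    by rewrite -[leLHS](powRr0 t) ler_powR// addrK ltW.
  apply: ge0_subset_integral => //.
  - exact: measurable_funTS (measurable_Gamma_integrand _).
  - by move=> t _; rewrite lee_fin mulr_ge0 ?powR_ge0 ?expR_ge0.
  - by apply: subset_itvr; rewrite bnd_simp.
move: EG1; rewrite EGammaS//; have := EGamma_ge0 z.
by rewrite le_eqVlt => /orP[/eqP <-|//]; rewrite mule0 ltxx.
Qed.

Lemma Gamma_gt0 (z : R) : 0 < z -> 0 < Gamma z.
Proof.
by move=> z0; rewrite /Gamma /Rintegral fine_gt0// EGamma_gt0 ?EGamma_lty.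
Qed.

Lemma GammaS (z : R) : 0 < z -> Gamma (z + 1) = z * Gamma z.
Proof.
move=> z0; rewrite /Gamma /Rintegral -!/(EGamma _) EGammaS// fineM//.
by rewrite ge0_fin_numE ?EGamma_lty ?EGamma_ge0.
Qed.

Lemma Gamma_natS n : Gamma (n.+1%:R : R) = n`!%:R.
Proof.
elim: n => [|n IH]; first by rewrite /Gamma /Rintegral -/(EGamma _) EGamma1.
by rewrite -natr1 GammaS// IH factS natrM.
Qed.

End GammaFunction.

(** * Order statistics *)

Section IndependentEvents.
Context {d : measure_display} {Omega : measurableType d} {R : realType}.
Variables (P : probability Omega R) (n : nat) (A : 'I_n -> set Omega) (p : R).
Hypothesis mA : forall i, measurable (A i).
(** The two index sets are kept separate, rather than complementary, so that an induction can move a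
    single index out of [K]. *)
Let meetA (J K : {set 'I_n}) :=
  [set w | forall i, (i \in J -> A i w) /\ (i \in K -> ~ A i w)].

Let measurable_meetA (J K : {set 'I_n}) : measurable (meetA J K).
Proof.
rewrite (_ : meetA J K = (\bigcap_(i in [set` J]) A i) `&`
                         (\bigcap_(i in [set` K]) ~` A i)); last first.
  apply/seteqP; split=> [w wJK|w [wJ wK] i].
    by split=> i /=; have [] := wJK i.
  by split; [exact: wJ|exact: wK].
apply: measurableI; apply: fin_bigcap_measurable => // i _.
exact: measurableC.
Qed.

Let failures w : {set 'I_n} := [set i | ~~ `[< A i w >]]%SET.

Let meetA_failures w K : meetA (~: K)%SET K w <-> failures w = K.
Proof.
split=> [wK|<- i].
  apply/setP => i; rewrite inE; have [iJ iK] := wK i.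
  case: (boolP (i \in K)) => [/iK|iNK]; first by move/asboolPn.
  by apply/negbTE/negPn/asboolP/iJ; rewrite inE.
rewrite !inE negbK; split; first by move/asboolP.
by move/asboolPn.
Qed.

Let sets_below k := [seq K : {set 'I_n} <- enum {: {set 'I_n}} | (#|K| < k)%N].

(** Sorting outcomes by their exact failure set turns the event into a finite union. It is disjoint,
    since [meetA_failures] determines [K] from [w]. *)
Let few_failuresE k : [set w | (#|failures w| < k)%N] =
  \bigcup_(K in [set` sets_below k]) meetA (~: K)%SET K.
Proof.
apply/seteqP; split=> [w /= wk|w [K /= Kr /meetA_failures wK]].
  by exists (failures w); [rewrite /= mem_filter wk mem_enum|exact/meetA_failures].
by move: Kr; rewrite wK mem_filter => /andP[].
Qed.

Lemma measurable_few_failures k :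
  measurable [set w | (#|[set i | ~~ `[< A i w >]]%SET| < k)%N].
Proof.
by rewrite few_failuresE; exact: fin_bigcup_measurable.
Qed.

(** Independence and the common probability enter only through this product rule on intersections;
    complements are derived from it. *)
Hypothesis PA : forall J : {set 'I_n},
  P (\bigcap_(i in [set` J]) A i) = (p ^+ #|J|)%:E.

(** Induction on [#|K|]: dropping [x] from [K] and subtracting the outcomes where [A x] holds gives
    [p^j (1-p)^m - p^(j+1) (1-p)^m = p^j (1-p)^(m+1)]. Disjointness ensures that adding [x] to [J]
    raises its size by one. *)
Let probability_meetA (J K : {set 'I_n}) : {in J, forall x, x \notin K} ->
  P (meetA J K) = (p ^+ #|J| * (1 - p) ^+ #|K|)%:E.
Proof.
move mE : #|K| => m; elim: m K J mE => [|m IH] K J Km JK.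
  rewrite expr0 mulr1 -PA; congr (P _); apply/seteqP; split=> [w wJK i /=|w wJ i].
    by have [] := wJK i.
  by split; [exact: wJ|rewrite (cards0_eq Km) inE].
have [x xK] : exists x, x \in K by apply/card_gt0P; rewrite Km.
have xJ : x \notin J by apply: contraL xK; exact: JK.
have K'm : #|(K :\ x)%SET| = m by move: Km; rewrite (cardsD1 x) xK => -[].
have JK' : {in J, forall y, y \notin (K :\ x)%SET}.
  by move=> y /JK yK; rewrite !inE (negbTE yK) andbF.
have xJK' : {in (x |: J)%SET, forall y, y \notin (K :\ x)%SET}.
  by move=> y; rewrite !inE => /predU1P[->|/JK' ]; rewrite ?eqxx// !inE.
have -> : meetA J K = meetA J (K :\ x)%SET `\` meetA (x |: J)%SET (K :\ x)%SET.
  apply/seteqP; split=> [w wJK|w [wJK NwJK] i].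
    split=> [i|/(_ x)[+ _]].
      have [iJ iK] := wJK i; split=> //.
      by rewrite !inE => /andP[_]; exact: iK.
    by rewrite !inE eqxx => /(_ isT); have [_] := wJK x; apply.
  have [iJ iK] := wJK i; split=> // iinK.
  have [ix|ix] := eqVneq i x; last by apply: iK; rewrite !inE ix.
  rewrite ix => Ax; apply: NwJK => l; have [lJ lK] := wJK l; split=> //.
  by rewrite !inE => /orP[/eqP ->//|]; exact: lJ.
have PD (B C : set Omega) (mB : measurable B) (mC : measurable C) :
    P (B `\` C) = (P B - P (B `&` C))%E.
  by apply: measureD => //; rewrite ltey_eq fin_num_measure.
rewrite PD// (_ : _ `&` _ = meetA (x |: J)%SET (K :\ x)%SET); last first.
  apply/seteqP; split=> [w []//|w wJK]; split=> // i.
  have [iJ iK] := wJK i; split=> // iinJ; apply: iJ.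
  by rewrite !inE iinJ orbT.
rewrite !IH// cardsU1 xJ -EFinB; congr EFin.
by rewrite /= add1n !exprS; ring.
Qed.

Lemma probability_few_failures (k : nat) :
  P [set w | (#|[set i | ~~ `[< A i w >]]%SET| < k)%N] =
  (\sum_(j < k) 'C(n, j)%:R * ((1 - p) ^+ j * p ^+ (n - j)))%:E.
Proof.
rewrite few_failuresE.
transitivity (\sum_(K <- sets_below k) P (meetA (~: K)%SET K))%E.
  rewrite measure_fin_bigcup//; first last.
    by move=> K L _ _ [w [/meetA_failures <- /meetA_failures <-]].
  by rewrite -fsbig_seq// filter_uniq ?enum_uniq.
rewrite big_filter big_enum_cond/=.
under eq_bigr => K _.
  rewrite probability_meetA; last by move=> i; rewrite inE.
  over.
rewrite sumEFin; congr EFin.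
(* The failure sets are grouped by size: there are ['C(n, j)] of size [j], all equally likely. *)
transitivity (\sum_(j < k) \sum_(K : {set 'I_n} | #|K| == j)
    (1 - p) ^+ j * p ^+ (n - j)); last first.
  apply: eq_bigr => j _; rewrite sumr_const mulr_natl; congr (_ *+ _).
  by rewrite -[in RHS](card_ord n) -card_draws; apply: eq_card => K; rewrite inE.
rewrite (exchange_big_dep (fun K : {set 'I_n} => (#|K| < k)%N))/=; last first.
  by move=> j K _ /eqP ->.
apply: eq_bigr => K Kk; rewrite (big_pred1 (Ordinal Kk)) => [|j]; last first.
  by rewrite /= -val_eqE/= eq_sym.
by rewrite mulrC; congr (_ * _ ^+ _); rewrite cardsCs finset.setCK card_ord.
Qed.

End IndependentEvents.

Section OrderStatistics.
Context {Omega : Type} {R : realType} {n : nat}.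
Implicit Types Y : 'I_n -> Omega -> R.

(** In a sorted list the entries at most [x] form a prefix, so the entry at index [j.-1] exceeds [x]
    exactly when that prefix is shorter than [j]. The bounds on [j] keep the default value of [nth]
    out of reach. *)
Lemma order_stat_gt Y (j : nat) (w : Omega) (x : R) : (0 < j <= n)%N ->
  (x < order_stat Y j w) = (#|[set i | ~~ `[< (x < Y i w)%R >]]%SET| < j)%N.
Proof.
case: j => // j /= jn; rewrite /order_stat/=.
set t := [seq Y i w | i <- enum 'I_n]; set u := sort <=%R t.
have su : sorted <=%R u by exact: sort_le_sorted.
have szu : size u = n by rewrite size_sort size_map size_enum_ord.
have -> : #|[set i | ~~ `[< (x < Y i w)%R >]]%SET| = count (<= x) u.
  rewrite count_sort count_map -size_filter cardE enumT /enum_mem.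
  by congr size; apply: eq_filter => i /=; rewrite inE asboolb -leNgt.
rewrite ltnS; apply/idP/idP => [xj|cj].
  by rewrite leqNgt; apply: contraTN xj => /(nth_count_le 0 su); rewrite -leNgt.
by apply: nth_count_gt => //; rewrite cj szu.
Qed.

(** Two reals with the same strict lower bounds coincide, and each side exceeds [x] exactly when
    some [Y i w] does. *)
Lemma order_stat_max Y (i0 : 'I_n) (w : Omega) :
  order_stat Y n w = \big[Num.max/Y i0 w]_(i < n) Y i w.
Proof.
have n0 : (0 < n <= n)%N by rewrite leqnn (leq_trans _ (ltn_ord i0)).
have ltE x : (x < order_stat Y n w) = (x < \big[Num.max/Y i0 w]_(i < n) Y i w).
  rewrite order_stat_gt// -[X in (_ < X)%N](card_ord n) -cardsT.
  apply/idP/bigmax_gtP => [Nall|xY].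
    right; have /existsP[i] : [exists i, x < Y i w].
      apply: contraTT Nall => /existsPn Nx; rewrite -leqNgt subset_leq_card//.
      by apply/fintype.subsetP => i _; rewrite inE asboolb.
    by exists i.
  have [i xi] : exists i, x < Y i w.
    by case: xY => [xi0|[i _ xi]]; [exists i0|exists i].
  apply: proper_card; apply/properP; split; first exact/fintype.subsetP.
  by exists i; rewrite ?inE// negbK; apply/asboolP.
apply/eqP; rewrite eq_le !leNgt; apply/andP; split; apply/negP.
  by rewrite ltE ltxx.
by rewrite -ltE ltxx.
Qed.

(** A sum is invariant under permutation, so it may run over the sorted values, where taking the
    minimum of two entries amounts to taking the minimum of their ranks. The index [j] starts at 0,
    hence the rank [j.+1]. *)
Lemma cod_costE Y (k : nat) (w : Omega) : (0 < k <= n)%N ->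
  cod_cost Y k w = \sum_(j < n) order_stat Y (minn j.+1 k) w.
Proof.
move=> /andP[k0 kn]; rewrite /cod_cost /cod_time.
set t := order_stat Y k w.
pose u := sort <=%R [seq Y i w | i <- enum 'I_n].
have su : sorted <=%R u by exact: sort_le_sorted.
have szu : size u = n by rewrite size_sort size_map size_enum_ord.
transitivity (\sum_(y <- u) Num.min y t).
  rewrite (perm_big [seq Y i w | i <- enum 'I_n]) ?perm_sort//=.
  by rewrite big_map big_enum.
rewrite (big_nth 0) szu big_mkord; apply: eq_bigr => j _.
rewrite /t /order_stat -/u {t}; case: k k0 kn => //= k _ kn; rewrite minnSS/=.
have mono : {in [pred i | (i < size u)%N] &, {homo nth 0 u : i l / (i <= l)%N >-> i <= l}}.
  exact: (sorted_leq_nth le_trans le_refl).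
have [jk|kj] := leqP j k.
  by apply/min_idPl; apply: mono; rewrite ?inE ?szu.
by apply/min_idPr; apply: mono; rewrite ?inE ?szu// ltnW.
Qed.

End OrderStatistics.

(** * Expectation as the integral of the tail *)

Section TailExpectation.
Context {d : measure_display} {Omega : measurableType d} {R : realType}.
Variable P : probability Omega R.
Notation mu := (@lebesgue_measure R).

(* [T] may be negative on a null set, so the layer-cake formula is applied to
   its positive part. *)
Lemma tail_expectation (T : Omega -> R) (H : R -> R) (s v : R) :
  measurable_fun setT T -> 0 < s -> (forall x, P [set w | x < T w] = (H x)%:E) ->
  (forall x, x < s -> H x = 1) ->
  (\int[mu]_(x in `[s, +oo[) (H x)%:E = v%:E)%E ->
  T \in Lfun P 1 /\ ('E_P[T] = (s + v)%:E)%E.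
Proof.
move=> mT s0 PT H1 Hv.
pose U w := Num.max (T w) 0.
have mU : measurable_fun setT U by exact: measurable_maxr.
have U0 w : 0 <= U w by rewrite le_max lexx orbT.
pose X : {RV P >-> R} := HB.pack U (isMeasurableFun.Build _ _ _ _ U mU).
have cX x : 0 <= x -> ccdf X x = (H x)%:E.
  move=> x0; rewrite -PT; congr (P _); apply/seteqP; split=> w /=;
  by rewrite in_itv/= andbT /U lt_max (ltNge x 0) x0 orbF.
have EU : ('E_P[U] = (s + v)%:E)%E.
  rewrite -[U]/(X : _ -> _) ge0_expectation_ccdf//.
  (* The tail is 1 on the first piece, which contributes [s]; the second piece contributes [v]. *)
  rewrite (_ : `[0%R, +oo[%classic = `[0%R, s[ `|` `[s, +oo[); last first.
    by rewrite -itv_bndbnd_setU// bnd_simp ltW.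
  rewrite ge0_integral_setU//=; last 2 first.
  - by apply: measurable_funTS; exact: ccdf_measurable.
  - apply/disj_setPS => x /= []; rewrite !in_itv/= => /andP[_ xs].
    by rewrite andbT leNgt xs.
  rewrite EFinD; congr (_ + _)%E.
    rewrite (eq_integral (fun=> 1%E)) ?integral_cst//=.
      by rewrite lebesgue_measure_itv/= lte_fin s0 mul1e sube0.
    by move=> x; rewrite inE/= in_itv/= => /andP[x0 xs]; rewrite cX ?H1.
  rewrite -Hv; apply: eq_integral => x; rewrite inE/= in_itv/= andbT => sx.
  by rewrite cX// (le_trans (ltW s0)).
(* Since [0 < s], the tail at 0 is 1, so truncation changes [T] only on a null set. *)
pose N := ~` [set w | 0 < T w].
have mN : measurable [set w | 0 < T w].
  rewrite -[X in measurable X]setTI.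
  exact: (@measurable_fun_ltr _ _ _ _ (fun=> 0) T).
have PN : P N = 0%E by rewrite probability_setC// PT H1// subee.
have TU : ae_eq P setT (EFin \o T) (EFin \o U).
  exists N; split=> //; first exact: measurableC.
  move=> w /=; apply: contra_not => T0 _.
  by rewrite /U max_l// ltW.
have ET : ('E_P[T] = 'E_P[U])%E.
  rewrite unlock; apply: ae_eq_integral => //; exact/measurable_EFinP.
split; last by rewrite ET.
apply/Lfun1_integrable/integrableP; split; first exact/measurable_EFinP.
rewrite (ae_eq_integral (abse \o (EFin \o U)))//.
- rewrite (eq_integral (EFin \o U)); last first.
    by move=> w _ /=; rewrite ger0_norm.
  by move: EU; rewrite unlock => ->; exact: ltry.
- by apply: measurableT_comp => //; exact/measurable_EFinP.
- by apply: measurableT_comp => //; exact/measurable_EFinP.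
- exact: ae_eq_abse.
Qed.

End TailExpectation.

(** Integrability travels with each value because additivity of the expectation requires it. *)
Lemma expectation_sum_ord d (Omega : measurableType d) (R : realType)
    (P : probability Omega R) m (F : 'I_m -> Omega -> R) (e : 'I_m -> R) :
  (forall j, F j \in Lfun P 1 /\ ('E_P[F j] = (e j)%:E)%E) ->
  (fun w => \sum_(j < m) F j w) \in Lfun P 1 /\
  ('E_P[fun w => (\sum_(j < m) F j w)%R] = (\sum_(j < m) e j)%R%:E)%E.
Proof.
move=> FE; have -> : (fun w => \sum_(j < m) F j w) =
    \sum_(f <- [seq F j | j : 'I_m]) f.
  by apply/funext => w; rewrite big_image/= fct_sumE.
split.
  by rewrite big_image/= rpred_sum// => j _; have [] := FE j.
rewrite expectation_sum => [|f /mapP[j _ ->]]; last by have [] := FE j.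
by rewrite big_image/= -sumEFin; apply: eq_bigr => j _; have [] := FE j.
Qed.

(** * Expected order statistics and costs *)

Section OrderStatisticExpectation.
Context {d : measure_display} {Omega : measurableType d} {R : realType}.
Variable P : probability Omega R.
Notation mu := (@lebesgue_measure R).

(* [(n - a)(n - 1 - a) ... (n - k + 1 - a)], used for [k <= n] only since [n - i]
   is truncated. *)
Definition shifted_ffact (a : R) (n k : nat) : R := \prod_(i < k) ((n - i)%:R - a).

Lemma shifted_ffactS a n k :
  shifted_ffact a n k.+1 = shifted_ffact a n k * ((n - k)%:R - a).
Proof. by rewrite /shifted_ffact big_ord_recr. Qed.

Lemma shifted_ffactSS a n k :
  shifted_ffact a n.+1 k.+1 = (n.+1%:R - a) * shifted_ffact a n k.
Proof.
by rewrite /shifted_ffact big_ord_recl subn0.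
Qed.

Lemma shifted_ffact_gt0 a n k : a < 1 -> (k <= n)%N -> 0 < shifted_ffact a n k.
Proof.
move=> a1 kn; apply: prodr_gt0 => i _; rewrite subr_gt0 (lt_le_trans a1)//.
by rewrite ler1n subn_gt0 (leq_trans (ltn_ord i)).
Qed.

Lemma shifted_ffact0 n k : shifted_ffact 0 n k = (n ^_ k)%:R.
Proof.
elim: k => [|k IH]; first by rewrite /shifted_ffact big_ord0.
by rewrite shifted_ffactS IH ffactnSr natrM subr0.
Qed.

Variables (s kappa a : R) (g : R -> R).
Hypotheses (s_gt0 : 0 < s) (a_lt1 : a < 1).
Hypothesis mg : measurable_fun `[s, +oo[ g.
Hypothesis g01 : forall x, s <= x -> 0 <= g x <= 1.
Hypothesis int_g : forall m, (0 < m)%N ->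
  (\int[mu]_(x in `[s, +oo[) (g x ^+ m)%:E = (kappa / (m%:R - a))%:E)%E.

(* A Beta integral, from
   [(1 - g)^j g^m = (1 - g)^(j + 1) g^m + (1 - g)^j g^(m + 1)]. *)
Lemma integral_bernstein j m : (0 < m)%N ->
  (\int[mu]_(x in `[s, +oo[) ((1 - g x) ^+ j * g x ^+ m)%:E =
   (kappa * (j`!%:R / shifted_ffact a (m + j) j.+1))%:E)%E.
Proof.
elim: j m => [|j IH] m m0.
  under eq_integral do rewrite expr0 mul1r.
  by rewrite int_g// addn0 shifted_ffactS /shifted_ffact big_ord0 subn0 !mul1r.
have f0 i l x : s <= x -> 0 <= (1 - g x) ^+ i * g x ^+ l.
  by move=> /g01/andP[g0 g1]; rewrite mulr_ge0 ?exprn_ge0 ?subr_ge0.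
have mf i l : measurable_fun `[s, +oo[ (EFin \o (fun x => (1 - g x) ^+ i * g x ^+ l)).
  apply/measurable_EFinP; apply: measurable_funM; apply: measurable_funX => //.
  exact: measurable_funB.
have E : (\int[mu]_(x in `[s, +oo[) ((1 - g x) ^+ j * g x ^+ m)%:E =
    \int[mu]_(x in `[s, +oo[) ((1 - g x) ^+ j.+1 * g x ^+ m)%:E +
    \int[mu]_(x in `[s, +oo[) ((1 - g x) ^+ j * g x ^+ m.+1)%:E)%E.
  rewrite -ge0_integralD//.
  - by apply: eq_integral => x _; rewrite -EFinD; congr EFin; rewrite !exprS; ring.
  - by move=> x; rewrite /= in_itv/= andbT lee_fin => sx; exact: f0.
  - exact: mf.
  - by move=> x; rewrite /= in_itv/= andbT lee_fin => sx; exact: f0.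
  - exact: mf.
move: E; rewrite (IH m)// (IH m.+1)//; set I := (\int[mu]_(x in _) _)%E => E.
have -> : I = ((kappa * (j`!%:R / shifted_ffact a (m + j) j.+1))%:E -
    (kappa * (j`!%:R / shifted_ffact a (m.+1 + j) j.+1))%:E)%E.
  by rewrite E addeK.
rewrite -EFinB; congr EFin.
have Q0 : shifted_ffact a (m + j) j.+1 != 0.
  by rewrite gt_eqF// shifted_ffact_gt0// -addn1 addnC leq_add2r.
have ma0 : m%:R - a != 0.
  by rewrite gt_eqF// subr_gt0 (lt_le_trans a_lt1)// ler1n.
have mja0 : (m + j).+1%:R - a != 0.
  by rewrite gt_eqF// subr_gt0 (lt_le_trans a_lt1)// ler1n.
(* Raising [m] by one shifts the window of factors: the factor [m + j + 1 - a] enters at the top and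
   [m - a] leaves at the bottom. *)
have -> : shifted_ffact a (m.+1 + j) j.+1 =
    ((m + j).+1%:R - a) * shifted_ffact a (m + j) j.+1 / (m%:R - a).
  by rewrite -shifted_ffactSS (shifted_ffactS _ _ j.+1) subSS addnK mulfK ?addSn.
rewrite addnS shifted_ffactSS factS natrM.
by move: ma0 mja0; rewrite -!natr1 natrD => ma0 mja0; field; rewrite ma0 mja0 Q0.
Qed.

Variables (n : nat) (Y : 'I_n -> Omega -> R).
Hypothesis mY : forall i, measurable_fun setT (Y i).
(** Only joint tails are prescribed, a form satisfied both by independent tasks and by minima over
    replicas. *)
Hypothesis PY : forall x (J : {set 'I_n}),
  P (\bigcap_(i in [set` J]) [set w | x < Y i w]) =
  ((if s <= x then g x else 1) ^+ #|J|)%:E.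

(** The binomial tail is integrated term by term with [integral_bernstein] at [m = n - j], positive
    since [j < k <= n]; then ['C(n, j) * j!] is the falling factorial [n ^_ j]. *)
Lemma expectation_order_stat k : (0 < k <= n)%N ->
  order_stat Y k \in Lfun P 1 /\
  ('E_P[order_stat Y k] =
    (s + kappa * \sum_(j < k) (n ^_ j)%:R / shifted_ffact a n j.+1)%:E)%E.
Proof.
move=> k0n; have /andP[k0 kn] := k0n.
pose G x := if s <= x then g x else 1.
pose H x := \sum_(j < k) 'C(n, j)%:R * ((1 - G x) ^+ j * G x ^+ (n - j)).
pose A x i := [set w | x < Y i w].
have mA x i : measurable (A x i).
  rewrite -[X in measurable X]setTI.
  exact: (@measurable_fun_ltr _ _ _ _ (fun=> x) (Y i)).
have setE x : [set w | x < order_stat Y k w] =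
    [set w | (#|[set i | ~~ `[< A x i w >]]%SET| < k)%N].
  by apply/seteqP; split=> w /=; rewrite order_stat_gt.
apply: (@tail_expectation _ _ _ _ _ H) => //.
- move=> mD; apply: (measurability _ (RGenOInfty.measurableE R)) => //.
  move=> /= _ [_ [x ->] <-]; apply: measurableI => //.
  rewrite preimage_itvoy setE.
  exact: measurable_few_failures.
- by move=> x; rewrite setE (probability_few_failures (mA x) (PY x)).
(* Below [s] every lifetime exceeds [x], so only the term [j = 0] survives and equals 1. *)
- move=> x xs; rewrite /H /G leNgt xs/=; case: k k0 {k0n kn H setE} => // k _.
  rewrite big_ord_recl/= bin0 subrr !expr1n mulr1 expr0 mulr1 big1 ?addr0// => i _.
  by rewrite exprS !mul0r mulr0.
transitivity (\sum_(j < k) \int[mu]_(x in `[s, +oo[)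
    ('C(n, j)%:R%:E * ((1 - g x) ^+ j * g x ^+ (n - j))%:E))%E.
  rewrite -ge0_integral_sum//=.
  - apply: eq_integral => x; rewrite inE/= in_itv/= andbT => sx.
    by rewrite /H /G sx -sumEFin.
  - move=> j; apply: measurable_funeM; apply/measurable_EFinP.
    apply: measurable_funM; apply: measurable_funX => //.
    exact: measurable_funB.
  - move=> j x; rewrite /= in_itv/= andbT => /g01/andP[g0 g1].
    by rewrite lee_fin !mulr_ge0 ?exprn_ge0 ?subr_ge0.
rewrite mulr_sumr -sumEFin; apply: eq_bigr => j _.
rewrite ge0_integralZl_EFin//.
- have jn : (j < n)%N := leq_trans (ltn_ord j) kn.
  rewrite integral_bernstein ?subn_gt0// subnK 1?ltnW// -EFinM; congr EFin.
  by rewrite -bin_ffact natrM; ring.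
- move=> x; rewrite /= in_itv/= andbT => /g01/andP[g0 g1].
  by rewrite lee_fin !mulr_ge0 ?exprn_ge0 ?subr_ge0.
- apply/measurable_EFinP.
  apply: measurable_funM; apply: measurable_funX => //.
  exact: measurable_funB.
Qed.

(** Exchanging the double sum, the term of index [i] occurs once for each [j] with [i <= j < n],
    that is [n - i] times, and [n ^_ i * (n - i) = n ^_ i.+1]. *)
Lemma expectation_cod_cost k : (0 < k <= n)%N ->
  cod_cost Y k \in Lfun P 1 /\
  ('E_P[cod_cost Y k] =
    (n%:R * s + kappa * \sum_(j < k) (n ^_ j.+1)%:R / shifted_ffact a n j.+1)%:E)%E.
Proof.
move=> k0n; have /andP[k0 kn] := k0n.
have jk0n (j : 'I_n) : (0 < minn j.+1 k <= n)%N.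
  by rewrite leq_min k0/= geq_min kn orbT.
rewrite (_ : cod_cost Y k =
    fun w => \sum_(j < n) order_stat Y (minn j.+1 k) w); last first.
  by apply/funext => w; rewrite cod_costE.
have [L ->] := expectation_sum_ord (fun j => expectation_order_stat (jk0n j)).
split; first exact: L.
congr EFin.
rewrite big_split/= sumr_const card_ord mulr_natl -mulr_sumr; congr (_ + _ * _).
pose f j : R := (n ^_ j)%:R / shifted_ffact a n j.+1.
transitivity (\sum_(j < n) \sum_(i < k | (i <= j)%N) f i).
  apply: eq_bigr => j _; rewrite (big_ord_widen k f) ?geq_minr//.
  by apply: eq_bigl => i; rewrite leq_min ltn_ord andbT ltnS.
rewrite (exchange_big_dep xpredT)//=; apply: eq_bigr => i _.
rewrite -(big_geq_mkord i n xpredT (fun=> f i)) sumr_const_nat -[LHS]mulr_natr.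
by rewrite ffactnSr natrM /f mulrAC.
Qed.

End OrderStatisticExpectation.

Lemma harmonic_numberS (R : realType) m :
  harmonic_number m.+1 = harmonic_number m + m.+1%:R^-1 :> R.
Proof. by rewrite /harmonic_number big_nat_recr. Qed.

(** * Exponential and Pareto lifetimes, replicas *)

Section Distributions.
Context {d : measure_display} {Omega : measurableType d} {R : realType}.
Variable P : probability Omega R.
Notation mu := (@lebesgue_measure R).

Lemma independent_tails (I : finType) (X : I -> {RV P >-> R}) (G : R -> R)
    (x : R) (J : {set I}) :
  mutually_independent X -> (forall i, ccdf (X i) x = (G x)%:E) ->
  P (\bigcap_(i in [set` J]) [set w | x < X i w]) = (G x ^+ #|J|)%:E.
Proof.
move=> indX XG; have := indX J (fun=> `]x, +oo[%classic) (fun=> measurable_itv _).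
under eq_bigcapr do rewrite preimage_itvoy.
move=> ->.
transitivity (\prod_(i in J) (G x)%:E)%E; last by rewrite prodEFin prodr_const.
by apply: eq_bigr => i _; rewrite -(XG i).
Qed.

Section Samples.
Variables (n : nat) (Y : 'I_n -> Omega -> R) (s : R).
Hypotheses (s_gt0 : 0 < s) (mY : forall i, measurable_fun setT (Y i)).

(** With [a = 0] the shifted products are ordinary falling factorials: the terms of the time become
    [1 / (n - j)], which add up to a difference of harmonic numbers, and those of the cost all
    become 1. *)
Lemma SExp_order_stat (m : R) k : 0 < m -> (0 < k <= n)%N ->
  (forall x (J : {set 'I_n}), P (\bigcap_(i in [set` J]) [set w | x < Y i w]) =
     ((if s <= x then expR (- m * (x - s)) else 1) ^+ #|J|)%:E) ->
  ('E_P[cod_time Y k] =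
     (s + m^-1 * (harmonic_number n - harmonic_number (n - k)))%:E)%E /\
  cod_cost Y k \in Lfun P 1 /\ ('E_P[cod_cost Y k] = (n%:R * s + k%:R / m)%:E)%E.
Proof.
move=> m0 k0n PY; have /andP[k0 kn] := k0n.
have mg : measurable_fun `[s, +oo[ (fun x => expR (- m * (x - s))).
  exact: measurable_expR_affine.
have g01 x : s <= x -> 0 <= expR (- m * (x - s)) <= 1.
  by move=> sx; rewrite expR_ge0 expR_le1 mulNr oppr_le0 mulr_ge0 ?subr_ge0// ltW.
have int_g l : (0 < l)%N ->
    (\int[mu]_(x in `[s, +oo[) (expR (- m * (x - s)) ^+ l)%:E =
     (m^-1 / (l%:R - 0))%:E)%E.
  move=> l0; rewrite subr0 -invfM -(@integral_expR_tail _ (m * l%:R) s).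
    by apply: eq_integral => x _; rewrite -expRM_natl; congr (expR _)%:E; ring.
  by rewrite mulr_gt0// ltr0n.
have [[_ E] [L C]] := (expectation_order_stat s_gt0 ltr01 mg g01 int_g mY PY k0n,
  expectation_cod_cost s_gt0 ltr01 mg g01 int_g mY PY k0n).
rewrite /cod_time E C; split; [|split; first exact: L]; congr EFin.
  congr (_ + _ * _); elim: k kn {PY k0n k0 E C L} => [|k IH] kn.
    by rewrite big_ord0 subn0 subrr.
  rewrite big_ord_recr/= IH; last exact: ltnW.
  rewrite !shifted_ffact0 ffactnSr natrM -(subnSK kn) harmonic_numberS.
  have nk0 : (n ^_ k)%:R != 0 :> R by rewrite pnatr_eq0 -lt0n ffact_gt0 ltnW.
  by rewrite invfM mulVKf//; ring.
rewrite (eq_bigr (fun=> 1)) => [|j _].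
  by rewrite sumr_const card_ord [_^-1 * _]mulrC.
rewrite shifted_ffact0 divff// pnatr_eq0 -lt0n ffact_gt0.
exact: leq_trans (ltn_ord j) kn.
Qed.

(** Both sums telescope, so the closed forms follow by induction on [k]. For the time, the ratio of
    consecutive values is [(n - k) / (n - k - 1/alpha)]. *)
Lemma Pareto_order_stat (alpha : R) k : 1 < alpha -> (0 < k <= n)%N ->
  (forall x (J : {set 'I_n}), P (\bigcap_(i in [set` J]) [set w | x < Y i w]) =
     ((if s <= x then (s / x) `^ alpha else 1) ^+ #|J|)%:E) ->
  ('E_P[cod_time Y k] =
     (s * ((n ^_ k)%:R / shifted_ffact alpha^-1 n k))%:E)%E /\
  cod_cost Y k \in Lfun P 1 /\ ('E_P[cod_cost Y k] =
     (s * (n%:R / (alpha - 1)) *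
       (alpha - (n.-1 ^_ k)%:R / shifted_ffact alpha^-1 n k))%:E)%E.
Proof.
move=> a1 k0n PY; have /andP[k0 kn] := k0n.
have a0 : 0 < alpha by exact: lt_trans a1.
have ai1 : alpha^-1 < 1 by rewrite invf_lt1.
have mg : measurable_fun `[s, +oo[ (fun x => (s / x) `^ alpha).
  (* For [x >= s > 0] the inverse is the real power of exponent -1, and real powers are
     measurable. *)
  apply: (eq_measurable_fun (fun x => (s * x `^ (-1)) `^ alpha)) => [x|].
    rewrite inE/= in_itv/= andbT => sx.
    by rewrite powR_inv1// (le_trans (ltW s_gt0)).
  apply: measurable_funTS.
  apply: (@measurableT_comp _ _ _ _ _ _ (@powR R ^~ alpha)) => //.
  exact: measurable_funM.
have g01 x : s <= x -> 0 <= (s / x) `^ alpha <= 1.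
  move=> sx; have x0 : 0 < x by exact: lt_le_trans sx.
  rewrite powR_ge0 -(powRr0 (s / x)) ger_powR ?(ltW a0)//.
  by rewrite divr_gt0// ler_pdivrMr// mul1r.
have int_g l : (0 < l)%N ->
    (\int[mu]_(x in `[s, +oo[) ((s / x) `^ alpha ^+ l)%:E =
     (s / alpha / (l%:R - alpha^-1))%:E)%E.
  move=> l0; have al1 : 1 < alpha * l%:R.
    by rewrite (lt_le_trans a1)// ler_peMr ?ler1n// ltW.
  transitivity (s / (alpha * l%:R - 1))%:E; last first.
    congr EFin; field; rewrite (gt_eqF a0) subr_eq0 [l%:R * _]mulrC.
    by rewrite gt_eqF.
  rewrite -(@integral_powR_tail _ (alpha * l%:R) s)//.
  apply: eq_integral => x; rewrite inE/= in_itv/= andbT => sx.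
  by rewrite powRrM powR_mulrn// powR_ge0.
have Q0 i : (i <= n)%N -> shifted_ffact alpha^-1 n i != 0.
  by move=> le_in; rewrite gt_eqF ?shifted_ffact_gt0.
have nka0 i : (i < n)%N -> (n - i)%:R * alpha - 1 != 0.
  move=> lt_in; rewrite gt_eqF// subr_gt0 (lt_le_trans a1)// ler_peMl ?(ltW a0)//.
  by rewrite ler1n subn_gt0.
have [[_ E] [L C]] := (expectation_order_stat s_gt0 ai1 mg g01 int_g mY PY k0n,
  expectation_cod_cost s_gt0 ai1 mg g01 int_g mY PY k0n).
rewrite /cod_time E C; split; [|split; first exact: L]; congr EFin.
  elim: k kn {PY k0n k0 E C L} => [|k IH] kn.
    by rewrite big_ord0 /shifted_ffact big_ord0 divr1 mulr0 addr0 mulr1.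
  rewrite big_ord_recr/= mulrDr addrA IH; last exact: ltnW.
  rewrite shifted_ffactS ffactnSr natrM; field.
  by rewrite (gt_eqF a0) nka0// Q0// ltnW.
elim: k kn {PY k0n k0 E C L} => [|k IH] kn.
  rewrite big_ord0 /shifted_ffact big_ord0 divr1 ffactn0 mulr0 addr0; field.
  by rewrite subr_eq0 gt_eqF.
rewrite big_ord_recr/= mulrDr addrA IH; last exact: ltnW.
have -> : (n ^_ k.+1 = n * n.-1 ^_ k)%N by rewrite ffactnS.
have -> : (n.-1 ^_ k.+1)%:R = (n.-1 ^_ k)%:R * ((n - k)%:R - 1) :> R.
  rewrite ffactnSr natrM; congr (_ * _).
  have -> : (n - k = (n.-1 - k).+1)%N by lia.
  by rewrite -natr1 addrK.
rewrite shifted_ffactS natrM; field.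
by rewrite (gt_eqF a0) nka0// [alpha - 1 == 0]subr_eq0 (gt_eqF a1) Q0// ltnW.
Qed.


End Samples.
End Distributions.

(** * Replication as the case where all [k] of [k] tasks are required *)

Section Replicas.
Context {d : measure_display} {Omega : measurableType d} {R : realType}.
Variables (P : probability Omega R) (k c : nat).
Variable X : 'I_k -> 'I_c.+1 -> {RV P >-> R}.

Lemma rep_task_time_gt (i : 'I_k) (w : Omega) (x : R) :
  x < rep_task_time X i w <-> forall l, x < X i l w.
Proof.
rewrite /rep_task_time; split=> [xY l|xX].
  by apply: (lt_le_trans xY); exact: bigmin_le_cond.
by apply/bigmin_gtP; split=> [|l _]; exact: xX.
Qed.

Lemma measurable_rep_task_time i : measurable_fun setT (rep_task_time X i).
Proof.
move=> mD; apply: (measurability _ (RGenOInfty.measurableE R)) => //.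
move=> /= _ [_ [x ->] <-]; apply: measurableI => //; rewrite preimage_itvoy.
rewrite (_ : [set w | _] = \bigcap_(l in [set: 'I_c.+1]) [set w | x < X i l w]).
  apply: fin_bigcap_measurable => // l _; rewrite -[X in measurable X]setTI.
  exact: (@measurable_fun_ltr _ _ _ _ (fun=> x) (X i l)).
apply/seteqP; split=> w /=; first by move/rep_task_time_gt => h l _; exact: h.
by move=> h; apply/rep_task_time_gt => l; exact: h.
Qed.

(** All minima over [J] exceed [x] exactly when every copy in the rectangle of [J] and all replica
    indices does; this rectangle has [#|J| * c.+1] elements. *)
Lemma rep_task_tails (G : R -> R) (x : R) (J : {set 'I_k}) :
  mutually_independent (fun p : 'I_k * 'I_c.+1 => X p.1 p.2) ->
  (forall i l, ccdf (X i l) x = (G x)%:E) ->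
  P (\bigcap_(i in [set` J]) [set w | x < rep_task_time X i w]) =
  ((G x ^+ c.+1) ^+ #|J|)%:E.
Proof.
move=> indX XG.
have := independent_tails (finset.setX J [set: 'I_c.+1]%SET) indX (fun p => XG p.1 p.2).
rewrite cardsX cardsT card_ord [(#|J| * _)%N]mulnC exprM => <-; congr (P _).
apply/seteqP; split=> [w wJ [i l]/=|w wJ i /= iJ].
  by rewrite inE => /andP[iJ _]; have /rep_task_time_gt := wJ i iJ; exact.
by apply/rep_task_time_gt => l; apply: (wJ (i, l)); rewrite /= !inE iJ.
Qed.

Lemma rep_timeE (k_gt0 : (0 < k)%N) : rep_time k_gt0 X = cod_time (rep_task_time X) k.
Proof.
by apply/funext => w; rewrite /cod_time (order_stat_max _ (Ordinal k_gt0)).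
Qed.

(** When all [k] tasks are required, the completion time is their maximum, so no task time is cut
    short and the coding cost is the plain sum. *)
Lemma rep_costE : (0 < k)%N ->
  rep_cost X = c.+1%:R \o* cod_cost (rep_task_time X) k.
Proof.
move=> k_gt0; apply/funext => w; rewrite /rep_cost /= mulrC; congr (_ * _).
apply: eq_bigr => i _; apply/esym/min_idPl.
rewrite -rep_timeE /rep_time.
exact: le_bigmax_cond.
Qed.

End Replicas.


(** Each use of the functional equation contributes one factor of the shifted product. The condition
    [a < 1] keeps all arguments positive, where Euler's integral is finite and non-zero. *)
Lemma Gamma_shifted_ffact (R : realType) (a : R) n k : a < 1 -> (k <= n)%N ->
  Gamma ((n - k)%:R + 1 - a) / Gamma (n%:R + 1 - a) = (shifted_ffact a n k)^-1.
Proof.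
move=> a1; have z0 m : 0 < m%:R + 1 - a by rewrite -addrA ltr_wpDl// subr_gt0.
have G0 m : Gamma (m%:R + 1 - a) != 0 by rewrite gt_eqF// Gamma_gt0.
elim: k => [|k IH] kn; first by rewrite subn0 divff// /shifted_ffact big_ord0 invr1.
rewrite shifted_ffactS invfM -IH ?(ltnW kn)// -(subnSK kn) -natr1.
have := z0 (n - k.+1)%N; set w := _ + 1 - a => w0.
have -> : (n - k.+1)%:R + 1 + 1 - a = w + 1 by rewrite /w; ring.
by rewrite GammaS//; field; rewrite G0 gt_eqF.
Qed.

Theorem theorem5 (R : realType) (d : measure_display) (Omega : measurableType d)
    (P : probability Omega R) (k c n : nat) (s : R)
    (X : 'I_k -> 'I_c.+1 -> {RV P >-> R}) (Z : 'I_n -> {RV P >-> R})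
    (k_gt0 : (0 < k)%N) (k_lt_n : (k < n)%N) (s_gt0 : 0 < s) :
  (forall mu : R, 0 < mu ->
    (mutually_independent (fun p : 'I_k * 'I_c.+1 => X p.1 p.2) ->
     (forall i l, has_SExp_law s mu (X i l)) ->
       ('E_P[rep_time k_gt0 X] =
          (s + harmonic_number k / (c.+1%:R * mu))%:E)%E /\
       ('E_P[rep_cost X] = (k%:R * (c.+1%:R * s + mu^-1))%:E)%E) /\
    (mutually_independent Z ->
     (forall i, has_SExp_law s mu (Z i)) ->
       ('E_P[cod_time Z k] =
          (s + mu^-1 * (harmonic_number n - harmonic_number (n - k)))%:E)%E /\
       ('E_P[cod_cost Z k] = (n%:R * s + k%:R / mu)%:E)%E)) /\
  (forall alpha : R, 1 < alpha ->
    (mutually_independent (fun p : 'I_k * 'I_c.+1 => X p.1 p.2) ->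
     (forall i l, has_Pareto_law s alpha (X i l)) ->
       ('E_P[rep_time k_gt0 X] =
          (s * k`!%:R * (Gamma (1 - (c.+1%:R * alpha)^-1) /
             Gamma (k%:R + 1 - (c.+1%:R * alpha)^-1)))%:E)%E /\
       ('E_P[rep_cost X] =
          (s * k%:R * c.+1%:R * (alpha / (alpha - c.+1%:R^-1)))%:E)%E) /\
    (mutually_independent Z ->
     (forall i, has_Pareto_law s alpha (Z i)) ->
       ('E_P[cod_time Z k] =
          (s * (n`!%:R / (n - k)`!%:R) *
             (Gamma ((n - k)%:R + 1 - alpha^-1) /
              Gamma (n%:R + 1 - alpha^-1)))%:E)%E /\
       ('E_P[cod_cost Z k] =
          (s * (n%:R / (alpha - 1)) *
             (alpha - Gamma n%:R / Gamma (n - k)%:R *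
                (Gamma ((n - k)%:R + 1 - alpha^-1) /
                 Gamma (n%:R + 1 - alpha^-1))))%:E)%E)).
Proof.
have k_le_n := ltnW k_lt_n.
have kk : (0 < k <= k)%N by rewrite k_gt0 leqnn.
have kn : (0 < k <= n)%N by rewrite k_gt0.
have ifX x b (y : R) : (if b then y else 1) ^+ x = if b then y ^+ x else 1.
  by case: b => //; rewrite expr1n.
have cost e : cod_cost (rep_task_time X) k \in Lfun P 1 ->
    ('E_P[cod_cost (rep_task_time X) k] = e%:E)%E ->
    ('E_P[rep_cost X] = (c.+1%:R * e)%:E)%E.
  by move=> L E; rewrite (rep_costE X k_gt0) expectationZl// E EFinM.
have c0 : c.+1%:R != 0 :> R by [].
split=> [mu mu0|alpha a1]; split=> [indX lawX|indZ lawZ].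
- have cmu0 : 0 < c.+1%:R * mu by rewrite mulr_gt0.
  have [|E [L C]] := @SExp_order_stat _ _ _ P _ _ _ s_gt0
      (measurable_rep_task_time X) _ _ cmu0 kk.
    move=> x J; apply: etrans (rep_task_tails
        (G := fun x => if s <= x then expR (- mu * (x - s)) else 1)
        J indX (fun i l => lawX i l x)) _.
    congr EFin; congr (_ ^+ _); rewrite ifX; case: ifP => // _.
    by rewrite -expRM_natl; congr expR; ring.
  rewrite rep_timeE E (cost _ L C); split; congr EFin.
    by rewrite subnn [harmonic_number 0]big_geq// subr0 mulrC.
  move: (c.+1%:R : R) c0 => K K0.
  by field; rewrite K0 (gt_eqF mu0).
- have [||E [L C]] := @SExp_order_stat _ _ _ P _ Z _ s_gt0 _ _ _ mu0 kn.
  + by move=> i; exact: measurable_funPT.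
  + by move=> x J; exact: (independent_tails
        (G := fun x => if s <= x then expR (- mu * (x - s)) else 1)
        J indZ (fun i => lawZ i x)).
  by rewrite E C.
- have ca1 : 1 < c.+1%:R * alpha.
    by rewrite (lt_le_trans a1)// ler_peMl ?ler1n// ltW// (lt_trans ltr01).
  have [|E [L C]] := @Pareto_order_stat _ _ _ P _ _ _ s_gt0
      (measurable_rep_task_time X) _ _ ca1 kk.
    move=> x J; apply: etrans (rep_task_tails
        (G := fun x => if s <= x then (s / x) `^ alpha else 1)
        J indX (fun i l => lawX i l x)) _.
    congr EFin; congr (_ ^+ _); rewrite ifX; case: ifP => // _.
    by rewrite [c.+1%:R * _]mulrC powRrM powR_mulrn ?powR_ge0.
  rewrite rep_timeE E (cost _ L C); split; congr EFin.
    have := @Gamma_shifted_ffact _ (c.+1%:R * alpha)^-1 k k _ (leqnn k).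
    rewrite subnn add0r => ->; first by rewrite ffactnn mulrA.
    by rewrite invf_lt1// (lt_trans ltr01).
  (* With [n = k] the falling factorial [k.-1 ^_ k] is zero, so the subtracted term of the cost
     disappears. *)
  rewrite [(k.-1 ^_ k)%N]ffact_small ?prednK// mul0r subr0.
  have cam1 : alpha * c.+1%:R - 1 != 0 by rewrite subr_eq0 mulrC gt_eqF.
  move: (c.+1%:R : R) c0 cam1 => K K0 cam1.
  by field; rewrite K0 cam1.
- have [||E [L C]] := @Pareto_order_stat _ _ _ P _ Z _ s_gt0 _ _ _ a1 kn.
  + by move=> i; exact: measurable_funPT.
  + by move=> x J; exact: (independent_tails
        (G := fun x => if s <= x then (s / x) `^ alpha else 1)
        J indZ (fun i => lawZ i x)).
  have ai1 : alpha^-1 < 1 by rewrite invf_lt1// (lt_trans ltr01).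
  rewrite E C !(Gamma_shifted_ffact ai1 k_le_n); split; congr EFin.
    by rewrite -(ffact_fact k_le_n) natrM mulfK ?mulrA.
  have n0 : (0 < n)%N := leq_ltn_trans (leq0n k) k_lt_n.
  (* Since [k < n], both Gamma arguments are positive integers and the quotient is
     [(n-1)! / (n-k-1)!], the falling factorial [n.-1 ^_ k]. *)
  congr (_ * (_ - _ / _)).
  rewrite -{2}(prednK n0) Gamma_natS.
  have -> : (n - k = (n.-1 - k).+1)%N by lia.
  have kn1 : (k <= n.-1)%N by rewrite -ltnS prednK.
  by rewrite Gamma_natS -(ffact_fact kn1) natrM mulfK.
Qed.
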